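(* Let $\Gamma$ be a compact metric graph, $d\ge0$, and let $T=\mathrm{tconv}(\{D_1,\dots,D_n\})\subseteq\mathrm{Div}^d_{+,\mathbb R}(\Gamma)$ be the tropical convex hull of finitely many divisors $D_1,\dots,D_n\in\mathrm{Div}^d_{+,\mathbb R}(\Gamma)$. Then for any $E\in\mathrm{Div}^d_{+,\mathbb R}(\Gamma)$, we have $E\in T$ if and only if $\bigcup_{i=1}^n\Gamma_{\min}(f_{D_i-E})=\Gamma$. Furthermore, if $D_0$ is the $E$-reduced divisor in $T$ and $D\in T$ is arbitrary, then $$\Gamma_{\min}(f_{D-E})\subseteq\Gamma_{\min}(f_{D_0-E})=\bigcup_{i=1}^n\Gamma_{\min}(f_{D_i-E}).$$
   Context: $\Gamma$ is a compact metric graph (finitely many edges of finite length). An $\mathbb R$-divisor is a finite formal sum $\sum_p m_p(p)$, $m_p\in\mathbb R$, $p\in\Gamma$; effective means all $m_p\ge0$; degree is $\sum m_p$. $\mathrm{Div}^d_{+,\mathbb R}(\Gamma)$ is the set of effective $\mathbb R$-divisors of degree $d$. For a continuous piecewise-linear $f$ on $\Gamma$, $\Delta f=\sum_p\sigma_p(f)(p)$ where $-\sigma_p(f)$ is the sum of the outgoing slopes of $f$ at $p$. For effective $D_1,D_2$ of equal degree, $f_{D_2-D_1}$ is a continuous piecewise-linear function with $\Delta f_{D_2-D_1}=D_2-D_1$ (unique up to an additive constant). For continuous $f$, $\Gamma_{\min}(f)=f^{-1}(\min f)$. The metric is $\rho(D_1,D_2)=\max f_{D_2-D_1}-\min f_{D_2-D_1}$.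 The tropical segment $\mathrm{tconv}(D_1,D_2)$ is the image of $t\mapsto D_1+\Delta\min(t\rho(D_1,D_2),f_{D_2-D_1}-\min f_{D_2-D_1})$, $t\in[0,1]$. A set is tropically convex if it contains $\mathrm{tconv}(D_1,D_2)$ for any two of its elements; $\mathrm{tconv}(S)$ is the intersection of all tropically convex sets containing $S$ (such hulls of finite sets are compact). Let $\mathfrak S(D_2-D_1)=\int_\Gamma(f_{D_2-D_1}-\min f_{D_2-D_1})\,dx$ (length measure). For a compact tropically convex $T$ and $E\in\mathrm{Div}^d_{+,\mathbb R}(\Gamma)$, the $E$-reduced divisor in $T$ is the unique element of $T$ minimizing $D\mapsto\mathfrak S(D-E)$ on $T$. *)

(* Defs.v *)
From HB Require Import structures.
From mathcomp Require Import all_boot all_order all_algebra.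
From mathcomp Require Import all_classical all_reals all_analysis.

Set Implicit Arguments.
Unset Strict Implicit.
Unset Printing Implicit Defensive.

Import Order.TTheory GRing.Theory Num.Theory.
Import numFieldNormedType.Exports.

Local Open Scope classical_set_scope.
Local Open Scope ring_scope.

(* Loops and multiple edges are allowed.  The orientation of the edges only
   serves to parametrise edge e by [0, len e]. *)
Record metric_graph (R : realType) := MetricGraph {
  vert : finType;
  edge : finType;
  src : edge -> vert;
  tgt : edge -> vert;
  len : edge -> R;
  len_gt0 : forall e, 0 < len e;
  vert_gt0 : (0 < #|vert|)%N;
  graph_connected : forall u v : vert,
    connect [rel x y | [exists e, ((src e == x) && (tgt e == y))
                               || ((src e == y) && (tgt e == x))]] u v
}.

(* The points of the geometric realisation: a point is either a vertex or a
   pair (e, t), with 0 < t < len e, in the interior of the edge e. *)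
Definition gpoint (R : realType) (G : metric_graph R) : Type :=
  (vert G + {x : edge G * R | (0 < x.2 < len x.1)%R})%type.

Section MetricGraph.
Context {R : realType} {G : metric_graph R}.
Implicit Types (f : gpoint G -> R) (D E : gpoint G -> R) (e : edge G).

(* Unit-speed parametrisation of e by [0, len e] (clamped outside). *)
Definition edge_point e (t : R) : gpoint G :=
  if insub (e, t) is Some x then inr x
  else if t <= 0 then inl (src e) else inl (tgt e).

(* The pieces are closed intervals, so a piecewise linear function is
   continuous. *)
Definition piecewise_linear (a b : R) (g : R -> R) : Prop :=
  exists (m : nat) (x : nat -> R),
    [/\ x 0%N = a, x m = b,
        forall i, (i < m)%N -> x i < x i.+1 &
        forall i, (i < m)%N -> exists c s : R,
          forall t, x i <= t <= x i.+1 -> g t = c + s * t].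

(* A function on the graph is continuous iff its pullback to each closed edge
   is. *)
Definition graph_PL f : Prop :=
  forall e, piecewise_linear 0 (len e) (f \o edge_point e).

Definition slope_fwd (g : R -> R) (t : R) : R :=
  lim ((g (t + h) - g t) / h @[h --> 0^'+]).

Definition slope_bwd (g : R -> R) (t : R) : R :=
  lim ((g (t - h) - g t) / h @[h --> 0^'+]).

(* A loop at v contributes two outgoing directions. *)
Definition sum_outgoing_slopes f (p : gpoint G) : R :=
  match p with
  | inl v => \sum_(e | src e == v) slope_fwd (f \o edge_point e) 0
           + \sum_(e | tgt e == v) slope_bwd (f \o edge_point e) (len e)
  | inr x => let: (e, t) := val x in
             slope_fwd (f \o edge_point e) t + slope_bwd (f \o edge_point e) t
  end.

Definition laplacian f : gpoint G -> R := fun p => - sum_outgoing_slopes f p.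

(* The formal sum \sum_p m_p (p) is represented by the finitely supported
   function p |-> m_p. *)
Definition R_divisor D : Prop := finite_set [set p | D p != 0].

Definition effective D : Prop := forall p, 0 <= D p.

Definition degree D : R := \sum_(p \in [set: gpoint G]) D p.

Definition Div_eff (d : R) : set (gpoint G -> R) :=
  [set D | [/\ R_divisor D, effective D & degree D = d]].

Definition fmin f : R := inf (range f).

Definition fmax f : R := sup (range f).

Definition Gamma_min f : set (gpoint G) := f @^-1` [set fmin f].

(* The potential of the degree 0 divisor D: a continuous piecewise linear f
   with laplacian f = D, chosen among those (they differ by constants). *)
Definition potential D : gpoint G -> R :=
  xget (fun _ => 0) [set f | graph_PL f /\ laplacian f = D].

Definition rho D1 D2 : R :=
  fmax (potential (D2 - D1)) - fmin (potential (D2 - D1)).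

Definition tsegment D1 D2 : set (gpoint G -> R) :=
  let f := potential (D2 - D1) in
  [set D1 + laplacian (fun p => Num.min (t * rho D1 D2) (f p - fmin f))
     | t in `[0, 1]%classic].

Definition tropically_convex (d : R) (A : set (gpoint G -> R)) : Prop :=
  A `<=` Div_eff d /\
  forall D1 D2, A D1 -> A D2 -> tsegment D1 D2 `<=` A.

Definition tconv (d : R) (S : set (gpoint G -> R)) : set (gpoint G -> R) :=
  \bigcap_(A in [set A | tropically_convex d A /\ S `<=` A]) A.

Definition graph_integral f : R :=
  \sum_e (\int[lebesgue_measure]_(t in `[0%R, len e]) f (edge_point e t))%R.

(* frak_S D is the functional written S(D2 - D1) for D = D2 - D1. *)
Definition frak_S D : R :=
  graph_integral (fun p => potential D p - fmin (potential D)).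

(* D0 is the E-reduced divisor in T; on a compact tropically convex T there is
   exactly one such D0. *)
Definition is_reduced (T : set (gpoint G -> R)) E D0 : Prop :=
  T D0 /\ forall D, T D -> frak_S (D0 - E) <= frak_S (D - E).

End MetricGraph.

(* Main.v *)
(** Write [F_i] for the potential of [D_i - E] normalized to have minimum 0, and
    let [g] be the pointwise minimum of the [F_i].  In terms of potentials
    relative to [E], the tropical segment from [f1] to [f2] consists of the
    functions [min (f1 + a) (f2 + b)].  Hence [E + laplacian g] belongs to [T],
    and the divisors whose normalized potential dominates [g] form a tropically
    convex set, which therefore contains [T].  So [g] is the least normalized
    potential of an element of [T]: it is that of the [E]-reduced divisor, its
    zero set is the union of the sets [Gamma_min], and [E] is in [T] if and only
    if [g = 0].

    Potentials exist because Green functions of the edges reduce the problem to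
    divisors supported on the vertices, where the Laplacian is a matrix whose
    kernel consists of the constants by the maximum principle. *)

Require Import Defs.
From HB Require Import structures.
From mathcomp Require Import all_boot all_order all_algebra.
From mathcomp Require Import all_classical all_reals all_analysis.
From mathcomp Require Import ring lra.

Set Implicit Arguments.
Unset Strict Implicit.
Unset Printing Implicit Defensive.

Import Order.TTheory GRing.Theory Num.Theory.
Import numFieldNormedType.Exports.

Local Open Scope classical_set_scope.
Local Open Scope ring_scope.

(** * Piecewise linear functions on an interval *)

Section PiecewiseLinear.
Context {R : realType}.
Implicit Types (f g : R -> R) (a b c s t x y : R).

Definition affine_on g a b : Prop :=
  exists c s, forall t, a <= t <= b -> g t = c + s * t.

(** Concatenation of intervals replaces the indexed subdivision of [piecewise_linear], which allows
    proofs by induction. The two notions agree when [a < b]. *)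
Inductive pl g : R -> R -> Prop :=
| pl_affine a b : a < b -> affine_on g a b -> pl g a b
| pl_cat a c b : pl g a c -> pl g c b -> pl g a b.

Lemma pl_lt g a b : pl g a b -> a < b.
Proof. by elim=> // {}a c {}b _ ac _ cb; apply: lt_trans cb. Qed.

Lemma pl_piecewise_linear g a b : pl g a b -> piecewise_linear a b g.
Proof.
elim=> {a b} [a b ab [c [s gE]]|a c b plac [m [x [x0 xm xlt xaff]]] _
    [k [y [y0 yk ylt yaff]]]].
  exists 1%N, (fun i => if i is 0%N then a else b).
  split=> // [[]//|[]// _]; by exists c, s.
exists (m + k)%N, (fun i => if (i <= m)%N then x i else y (i - m)%N).
have step i : (i < m + k)%N ->
    (i < m)%N \/ exists2 j, i = (m + j)%N & (j < k)%N.
  move=> ik; case: (ltnP i m) => [|mi]; [by left|right].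
  by exists (i - m)%N; [rewrite subnKC|rewrite ltn_subLR].
have yE j : (if (m + j <= m)%N then x (m + j)%N else y (m + j - m)%N) = y j.
  rewrite addKn; case: j => [|j]; first by rewrite addn0 leqnn xm y0.
  by rewrite -[X in (_ <= X)%N]addn0 leq_add2l.
split=> //.
- by rewrite yE.
- move=> i /step[im|[j -> jk]]; first by rewrite im ltnW// xlt.
  by rewrite -addnS !yE; apply: ylt.
- move=> i /step[im|[j -> jk]]; first by rewrite im ltnW//; apply: xaff.
  by rewrite -addnS !yE; apply: yaff.
Qed.

Lemma piecewise_linear_pl g a b : a < b -> piecewise_linear a b g -> pl g a b.
Proof.
move=> ab [m [x [x0 xm xlt xaff]]].
have H k : (k < m)%N -> pl g (x 0%N) (x k.+1).
  elim: k => [|k IH] km; first by apply: pl_affine; [exact: xlt|exact: xaff].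
  apply: pl_cat (IH (ltnW km)) _.
  by apply: pl_affine; [exact: xlt|exact: xaff].
case: m xm H {xlt xaff} => [|m] xm H; last by rewrite -x0 -xm; apply: H.
by move: ab; rewrite -x0 -xm ltxx.
Qed.

Lemma pl_restrict g a b x y : pl g a b -> a <= x -> x < y -> y <= b -> pl g x y.
Proof.
move=> H; elim: H x y => {a b} [a b ab [c [s gE]]|a c b _ IH1 _ IH2] x y ax xy yb.
  by apply: pl_affine => //; exists c, s => t tin; apply: gE; lra.
case: (lerP y c) => yc; first exact: IH1.
case: (lerP c x) => cx; first exact: IH2.
by apply: (@pl_cat _ _ c); [apply: IH1|apply: IH2] => //; lra.
Qed.

(** An induction principle that stands in for a common refinement: [g] is restricted to each piece
    of [f], and inside a piece on which [f] is affine the induction runs over the pieces of [g]. *)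
Lemma pl_common (P : R -> R -> Prop) f g a b :
  (forall a b, a < b -> affine_on f a b -> affine_on g a b -> P a b) ->
  (forall a c b, P a c -> P c b -> P a b) ->
  pl f a b -> pl g a b -> P a b.
Proof.
move=> Paff Pcat; elim=> {a b} [a b ab faff|a c b plf1 IH1 plf2 IH2] plg.
  elim: plg ab faff => {a b} [a b ab gaff _ faff|a c b plg1 IH1 plg2 IH2 ab].
    exact: Paff.
  move=> [c0 [s fE]]; have := pl_lt plg1; have := pl_lt plg2 => cb ac.
  by apply: (Pcat a c b); [apply: IH1|apply: IH2] => //; exists c0, s => t tin;
    apply: fE; lra.
have := pl_lt plf1; have := pl_lt plf2 => cb ac.
by apply: (Pcat a c b); [apply: IH1|apply: IH2] => //;
  apply: pl_restrict plg _ _ _ => //; lra.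
Qed.

Lemma eq_pl f g a b : (forall t, a <= t <= b -> f t = g t) -> pl f a b -> pl g a b.
Proof.
move=> fg H; elim: H fg => {a b} [a b ab [c [s fE]] fg|a c b H1 IH1 H2 IH2 fg].
  by apply: pl_affine => //; exists c, s => t tin; rewrite -fg// fE.
have := pl_lt H1; have := pl_lt H2 => cb ac.
by apply: (@pl_cat _ _ c); [apply: IH1|apply: IH2] => t tin; apply: fg; lra.
Qed.

Lemma pl_add f g a b : pl f a b -> pl g a b -> pl (fun t => f t + g t) a b.
Proof.
apply: pl_common => [{}a {}b ab [c [s fE]] [c' [s' gE]]|]; last exact: pl_cat.
apply: pl_affine => //; exists (c + c'), (s + s') => t tin.
by rewrite fE// gE//; ring.
Qed.

Lemma pl_scale k f a b : pl f a b -> pl (fun t => k * f t) a b.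
Proof.
elim=> {a b} [a b ab [c [s fE]]|a c b _ + _]; last exact: pl_cat.
by apply: pl_affine => //; exists (k * c), (k * s) => t tin; rewrite fE//; ring.
Qed.

Lemma pl_linear k s a b : a < b -> pl (fun t => k + s * t) a b.
Proof. by move=> ab; apply: pl_affine => //; exists k, s. Qed.

Lemma pl_min0 f a b : pl f a b -> pl (fun t => Num.min 0 (f t)) a b.
Proof.
elim=> {a b} [a b ab [c [s fE]]|a c b _ + _]; last exact: pl_cat.
have neg x y : a <= x -> x < y -> y <= b -> f x <= 0 -> f y <= 0 ->
    pl (fun t => Num.min 0 (f t)) x y.
  move=> ax xy yb fx fy; apply: pl_affine => //; exists c, s => t tin.
  rewrite -fE; last lra.
  apply: min_r; move: fx fy; rewrite !fE; [nra|lra..].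
have pos x y : a <= x -> x < y -> y <= b -> 0 <= f x -> 0 <= f y ->
    pl (fun t => Num.min 0 (f t)) x y.
  move=> ax xy yb fx fy; apply: pl_affine => //; exists 0, 0 => t tin.
  rewrite min_l; first by ring.
  move: fx fy; rewrite !fE; [nra|lra..].
case: (lerP (f a) 0) => fa; case: (lerP (f b) 0) => fb.
- by apply: neg.
(* The piece is cut at the zero [- c / s] of [c + s * t], unless that zero is the endpoint [a],
   where the cut would be degenerate. *)
- have [fa0|fa0] := eqVneq (f a) 0; first by apply: pos; rewrite ?fa0 ?(ltW fb).
  have fa1 : f a < 0 by rewrite lt_neqAle fa0.
  have faE : f a = c + s * a by apply: fE; lra.
  have fbE : f b = c + s * b by apply: fE; lra.
  have s0 : 0 < s by nra.
  have sz : s * (- c / s) = - c by field; apply: lt0r_neq0.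
  have z1 : a < - c / s by nra.
  have z2 : - c / s < b by nra.
  have fz : f (- c / s) = 0 by rewrite fE ?sz; lra.
  by apply: (@pl_cat _ _ (- c / s)); [apply: neg|apply: pos]; rewrite ?fz; lra.
- have [fb0|fb0] := eqVneq (f b) 0; first by apply: pos; rewrite ?fb0 ?(ltW fa).
  have fb1 : f b < 0 by rewrite lt_neqAle fb0.
  have faE : f a = c + s * a by apply: fE; lra.
  have fbE : f b = c + s * b by apply: fE; lra.
  have s0 : s < 0 by nra.
  have sz : s * (- c / s) = - c by field; apply: ltr0_neq0.
  have z1 : a < - c / s by nra.
  have z2 : - c / s < b by nra.
  have fz : f (- c / s) = 0 by rewrite fE ?sz; lra.
  by apply: (@pl_cat _ _ (- c / s)); [apply: pos|apply: neg]; rewrite ?fz; lra.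
- by apply: pos => //; lra.
Qed.

(** Since min(f, g) = f + min(0, g - f), only the zeros of one function have to be added as
    breakpoints. *)
Lemma pl_min f g a b : pl f a b -> pl g a b ->
  pl (fun t => Num.min (f t) (g t)) a b.
Proof.
move=> plf plg; have := pl_add plf (pl_min0 (pl_add plg (pl_scale (-1) plf))).
apply: eq_pl => t _; rewrite !minEle.
by case: ifP; case: ifP => h1 h2; lra.
Qed.

Lemma pl_argmin f a b : pl f a b ->
  exists2 x, a <= x <= b & forall t, a <= t <= b -> f x <= f t.
Proof.
elim=> {a b} [a b ab [c [s fE]]|a c b H1 [x xin xm] H2 [y yin ym]].
  case: (lerP 0 s) => s0; [exists a|exists b]; rewrite ?lexx ?ltW// => t tin;
    by rewrite !fE; [nra|lra..].
have := pl_lt H1; have := pl_lt H2 => cb ac.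
case: (lerP (f x) (f y)) => fxy; [exists x|exists y]; try lra; move=> t tin;
  by case: (lerP t c) => tc; [have := xm t|have := ym t]; lra.
Qed.

(** This bound later yields both integrability and an interval on which a positive value persists.
    Under concatenation the constants are added. *)
Lemma pl_lipschitz f a b : pl f a b ->
  exists2 K, 0 <= K &
    forall x y, a <= x <= b -> a <= y <= b -> `|f x - f y| <= K * `|x - y|.
Proof.
suff H : pl f a b -> exists2 K, 0 <= K &
    forall x y, a <= x -> x <= y -> y <= b -> `|f x - f y| <= K * (y - x).
  move=> /H[K K0 HK]; exists K => // x y xin yin.
  case/orP: (le_total x y) => xy.
    by rewrite [`|x - y|]ler0_norm ?opprB; [apply: HK|]; lra.
  by rewrite distrC [`|x - y|]ger0_norm; [apply: HK|]; lra.
elim=> {a b} [a b ab [c [s fE]]|a c b H1 [K K0 HK] H2 [L L0 HL]].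
  exists `|s| => // x y ax xy yb; rewrite !fE; [|lra..].
  by rewrite opprD addrACA subrr add0r -mulrBr normrM [`|x - y|]distrC
    [`|y - x|]ger0_norm// subr_ge0.
have := pl_lt H1; have := pl_lt H2 => cb ac.
exists (K + L) => [|x y ax xy yb]; first by rewrite addr_ge0.
case: (lerP y c) => yc; first by have := HK x y ax xy yc; nra.
case: (lerP c x) => cx; first by have := HL x y cx xy yb; nra.
have := HK x c ax (ltW cx) (lexx _); have := HL c y (lexx _) (ltW yc) yb.
have := ler_normD (f x - f c) (f c - f y); rewrite addrA subrK.
by nra.
Qed.

(** * One-sided slopes and kinks *)

Definition fwd_germ g t s : Prop :=
  exists2 e, 0 < e & forall h, 0 < h <= e -> g (t + h) = g t + s * h.

(** Here [h] measures the distance travelled away from [t], so [s] is the outgoing slope, the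
    opposite of the left derivative. *)
Definition bwd_germ g t s : Prop :=
  exists2 e, 0 < e & forall h, 0 < h <= e -> g (t - h) = g t + s * h.

Lemma germ_lim (u : R -> R) s e : 0 < e ->
  (forall h, 0 < h <= e -> u h = s) -> lim (u h @[h --> 0^'+]) = s.
Proof.
move=> e0 uE; apply: cvg_lim => //; apply: cvg_near_cst.
near=> h; apply: uE; apply/andP; split.
  by near: h; apply: nbhs_right_gt.
by near: h; apply: nbhs_right_le.
Unshelve. all: by end_near. Qed.

Lemma fwd_germE g t s : fwd_germ g t s -> slope_fwd g t = s.
Proof.
move=> [e e0 gE]; apply: (germ_lim e0) => h /[dup] /andP[h0 _] /gE ->.
by rewrite addrC addKr mulfK// gt_eqF.
Qed.

Lemma bwd_germE g t s : bwd_germ g t s -> slope_bwd g t = s.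
Proof.
move=> [e e0 gE]; apply: (germ_lim e0) => h /[dup] /andP[h0 _] /gE ->.
by rewrite addrC addKr mulfK// gt_eqF.
Qed.

Lemma affine_fwd_germ g a b c s t : (forall t, a <= t <= b -> g t = c + s * t) ->
  a <= t -> t < b -> fwd_germ g t s.
Proof.
move=> gE at_ tb; exists (b - t); first by lra.
by move=> h hin; rewrite !gE; [ring|lra..].
Qed.

Lemma affine_bwd_germ g a b c s t : (forall t, a <= t <= b -> g t = c + s * t) ->
  a < t -> t <= b -> bwd_germ g t (- s).
Proof.
move=> gE at_ tb; exists (t - a); first by lra.
by move=> h hin; rewrite !gE; [ring|lra..].
Qed.

Lemma pl_fwd_germ g a b t : pl g a b -> a <= t -> t < b ->
  fwd_germ g t (slope_fwd g t).
Proof.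
suff H : pl g a b -> a <= t -> t < b -> exists s, fwd_germ g t s.
  by move=> p at_ tb; have [s gs] := H p at_ tb; rewrite (fwd_germE gs).
elim=> {a b} [a b ab [c [s gE]] at_ tb|a c b _ IH1 _ IH2 at_ tb].
  by exists s; apply: affine_fwd_germ gE _ _.
by case: (lerP c t) => tc; [apply: IH2|apply: IH1].
Qed.

Lemma pl_bwd_germ g a b t : pl g a b -> a < t -> t <= b ->
  bwd_germ g t (slope_bwd g t).
Proof.
suff H : pl g a b -> a < t -> t <= b -> exists s, bwd_germ g t s.
  by move=> p at_ tb; have [s gs] := H p at_ tb; rewrite (bwd_germE gs).
elim=> {a b} [a b ab [c [s gE]] at_ tb|a c b _ IH1 _ IH2 at_ tb].
  by exists (- s); apply: affine_bwd_germ gE _ _.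
by case: (lerP t c) => tc; [apply: IH1|apply: IH2].
Qed.

Lemma slope_fwd_lin k f g a b t : pl f a b -> pl g a b -> a <= t -> t < b ->
  slope_fwd (fun x => k * f x + g x) t = k * slope_fwd f t + slope_fwd g t.
Proof.
move=> plf plg at_ tb; apply: fwd_germE.
have [e e0 fE] := pl_fwd_germ plf at_ tb.
have [e' e'0 gE] := pl_fwd_germ plg at_ tb.
exists (Num.min e e'); first by rewrite lt_min e0.
by move=> h; rewrite le_min => /and3P[h0 he he']; rewrite fE ?gE ?h0//; ring.
Qed.

Lemma slope_bwd_lin k f g a b t : pl f a b -> pl g a b -> a < t -> t <= b ->
  slope_bwd (fun x => k * f x + g x) t = k * slope_bwd f t + slope_bwd g t.
Proof.
move=> plf plg at_ tb; apply: bwd_germE.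
have [e e0 fE] := pl_bwd_germ plf at_ tb.
have [e' e'0 gE] := pl_bwd_germ plg at_ tb.
exists (Num.min e e'); first by rewrite lt_min e0.
by move=> h; rewrite le_min => /and3P[h0 he he']; rewrite fE ?gE ?h0//; ring.
Qed.

(** Both functions are linear up to the common step [Num.min e e'], and comparing their values at
    this single step compares the slopes. *)
Lemma slope_fwd_le f g a b t : pl f a b -> pl g a b -> a <= t -> t < b ->
  f t = g t -> (forall x, f x <= g x) -> slope_fwd f t <= slope_fwd g t.
Proof.
move=> plf plg at_ tb fgt fg.
have [e e0 fE] := pl_fwd_germ plf at_ tb.
have [e' e'0 gE] := pl_fwd_germ plg at_ tb.
have m0 : 0 < Num.min e e' by rewrite lt_min e0.
have := fg (t + Num.min e e').
rewrite fE ?gE ?m0 ?ge_min ?lexx ?orbT// fgt lerD2l.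
by rewrite ler_pM2r.
Qed.

Lemma slope_bwd_le f g a b t : pl f a b -> pl g a b -> a < t -> t <= b ->
  f t = g t -> (forall x, f x <= g x) -> slope_bwd f t <= slope_bwd g t.
Proof.
move=> plf plg at_ tb fgt fg.
have [e e0 fE] := pl_bwd_germ plf at_ tb.
have [e' e'0 gE] := pl_bwd_germ plg at_ tb.
have m0 : 0 < Num.min e e' by rewrite lt_min e0.
have := fg (t - Num.min e e').
rewrite fE ?gE ?m0 ?ge_min ?lexx ?orbT// fgt lerD2l.
by rewrite ler_pM2r.
Qed.

Definition kink g t : R := slope_fwd g t + slope_bwd g t.

(* The kinks telescope to the difference of the extremal slopes. *)
Lemma pl_kinks g a b : pl g a b ->
  exists r : seq R,
    [/\ uniq r, forall t, t \in r -> a < t < b,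
        forall t, a < t < b -> t \notin r -> kink g t = 0 &
        \sum_(t <- r) kink g t = - (slope_fwd g a + slope_bwd g b)].
Proof.
elim=> {a b} [a b ab [c [s gE]]|a c b H1 [r [ur rin r0 rS]] H2
    [r' [ur' rin' r0' rS']]].
  exists [::]; split=> // [t /andP[at_ tb] _|].
    by rewrite /kink (fwd_germE (affine_fwd_germ gE (ltW at_) tb))
      (bwd_germE (affine_bwd_germ gE at_ (ltW tb))) subrr.
  rewrite big_nil (fwd_germE (affine_fwd_germ gE (lexx a) ab)).
  by rewrite (bwd_germE (affine_bwd_germ gE ab (lexx b))) subrr oppr0.
have := pl_lt H1; have := pl_lt H2 => cb ac.
(* The breakpoint [c] becomes interior, and its kink cancels the two slopes at [c] that enter the
   inductive sums. *)
exists (r ++ c :: r'); split.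
- rewrite cat_uniq ur /= ur' andbT; apply/andP; split.
    rewrite negb_or; apply/andP; split.
      by apply/negP => /rin; rewrite ltxx andbF.
    by apply/hasPn => t /rin' tin; apply/negP => /rin; lra.
  by apply/negP => /rin'; rewrite ltxx.
- move=> t; rewrite mem_cat inE => /or3P[/rin|/eqP->|/rin']; lra.
- move=> t tin; rewrite mem_cat inE !negb_or => /and3P[tr /eqP tc tr'].
  case: (ltrgtP t c) => // tc'; [apply: r0|apply: r0'] => //; lra.
- by rewrite big_cat big_cons /= rS rS' /kink; ring.
Qed.

(** Two affine pieces that meet with kink 0 have the same slope, and their common value at the
    breakpoint makes the constant terms equal. *)
Lemma pl_affine_on g a b : pl g a b ->
  (forall t, a < t < b -> kink g t = 0) -> affine_on g a b.
Proof.
elim=> {a b} [//|a c b H1 IH1 H2 IH2 k0].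
have := pl_lt H1; have := pl_lt H2 => cb ac.
have [|c1 [s1 g1]] := IH1; first by move=> t tin; apply: k0; lra.
have [|c2 [s2 g2]] := IH2; first by move=> t tin; apply: k0; lra.
have := k0 c; rewrite /kink ac cb => /(_ isT).
rewrite (fwd_germE (affine_fwd_germ g2 (lexx c) cb)).
rewrite (bwd_germE (affine_bwd_germ g1 ac (lexx c))) => s12.
have s12' : s2 = s1 by lra.
have := g1 c; have := g2 c; rewrite !lexx (ltW ac) (ltW cb) => /(_ isT) -> /(_ isT).
rewrite s12' => cc; have {}cc : c2 = c1 by lra.
exists c1, s1 => t tin; case: (lerP t c) => tc; first by apply: g1; lra.
by rewrite g2 ?cc ?s12' //; lra.
Qed.

End PiecewiseLinear.

(** * Piecewise linear functions on the graph and their Laplacians *)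

Section Graph.
Context {R : realType} {G : metric_graph R}.
Implicit Types (f g : gpoint G -> R) (D E : gpoint G -> R) (e : edge G)
  (p q : gpoint G).

Lemma edge_point_interior e (t : R) (te : 0 < t < len e) :
  edge_point e t = inr (exist _ (e, t) te).
Proof.
rewrite /edge_point; case: insubP => [u _ uE|]; last by rewrite te.
by congr inr; apply: val_inj.
Qed.

Lemma edge_point0 e : edge_point e 0 = inl (src e).
Proof. by rewrite /edge_point insubF ?lexx//= ltxx. Qed.

Lemma edge_point_len e : edge_point e (len e) = inl (tgt e).
Proof.
rewrite /edge_point insubF/= ?ltxx ?andbF//.
by rewrite leNgt len_gt0.
Qed.

(** Presents an interior point as [edge_point e t], the form in which pullbacks to edges and
    [laplacian_interior] apply. *)
Variant gpoint_spec : gpoint G -> Prop :=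
| GVertex v : gpoint_spec (inl v)
| GInterior e t of 0 < t < len e : gpoint_spec (edge_point e t).

Lemma gpointP p : gpoint_spec p.
Proof.
case: p => [v|[[e t] te]]; first exact: GVertex.
by rewrite -edge_point_interior; apply: GInterior.
Qed.

Lemma edge_point_inj e e' t t' : 0 < t < len e -> 0 < t' < len e' ->
  edge_point e t = edge_point e' t' -> e = e' /\ t = t'.
Proof.
by move=> te te'; rewrite !edge_point_interior => -[-> ->].
Qed.

Lemma graph_PLP f :
  graph_PL f <-> forall e, pl (f \o edge_point e) 0 (len e).
Proof.
split=> H e; first by apply: piecewise_linear_pl (len_gt0 e) (H e).
exact: pl_piecewise_linear (H e).
Qed.

Lemma graph_PL_lin k f g : graph_PL f -> graph_PL g ->
  graph_PL (fun p => k * f p + g p).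
Proof.
move=> /graph_PLP plf /graph_PLP plg; apply/graph_PLP => e.
exact: pl_add (pl_scale k (plf e)) (plg e).
Qed.

Lemma graph_PL_cst k : graph_PL (fun _ : gpoint G => k).
Proof.
apply/graph_PLP => e; apply: pl_affine (len_gt0 e) _.
by exists k, 0 => t _; rewrite mul0r addr0.
Qed.

Lemma graph_PL_min f g : graph_PL f -> graph_PL g ->
  graph_PL (fun p => Num.min (f p) (g p)).
Proof.
move=> /graph_PLP plf /graph_PLP plg; apply/graph_PLP => e.
exact: pl_min (plf e) (plg e).
Qed.

Lemma graph_PL_addC f k : graph_PL f -> graph_PL (fun p => f p + k).
Proof.
move=> plf; have := graph_PL_lin 1 plf (graph_PL_cst k).
by under eq_fun do rewrite mul1r.
Qed.

Lemma laplacian_interior f e t : 0 < t < len e ->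
  laplacian f (edge_point e t) = - kink (f \o edge_point e) t.
Proof. by move=> te; rewrite edge_point_interior. Qed.

Lemma laplacian_lin k f g p : graph_PL f -> graph_PL g ->
  laplacian (fun p => k * f p + g p) p = k * laplacian f p + laplacian g p.
Proof.
move=> /graph_PLP plf /graph_PLP plg; case: (gpointP p) => [v|e t te].
  rewrite /laplacian /=.
  rewrite (eq_bigr (fun e => k * slope_fwd (f \o edge_point e) 0
    + slope_fwd (g \o edge_point e) 0)); last first.
    by move=> e _; apply: slope_fwd_lin (plf e) (plg e) _ _ => //; apply: len_gt0.
  rewrite [X in _ + X](eq_bigr (fun e => k * slope_bwd (f \o edge_point e) (len e)
    + slope_bwd (g \o edge_point e) (len e))); last first.
    by move=> e _; apply: slope_bwd_lin (plf e) (plg e) _ _ => //; apply: len_gt0.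
  by rewrite !big_split /= -!mulr_sumr; ring.
rewrite !laplacian_interior// /kink; case/andP: te => t0 tl.
have -> := slope_fwd_lin k (plf e) (plg e) (ltW t0) tl.
have -> := slope_bwd_lin k (plf e) (plg e) t0 (ltW tl).
by ring.
Qed.

Lemma laplacian_cst k p : laplacian (fun _ : gpoint G => k) p = 0.
Proof.
have Hf t : slope_fwd (fun _ : R => k) t = 0.
  by apply: fwd_germE; exists 1 => // h _; rewrite mul0r addr0.
have Hb t : slope_bwd (fun _ : R => k) t = 0.
  by apply: bwd_germE; exists 1 => // h _; rewrite mul0r addr0.
case: (gpointP p) => [v|e t te].
  by rewrite /laplacian /= !big1 ?addr0 ?oppr0// => e _; rewrite ?Hf ?Hb.
by rewrite laplacian_interior// /kink Hf Hb addr0 oppr0.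
Qed.

Lemma laplacian_addC f k p : graph_PL f ->
  laplacian (fun p => f p + k) p = laplacian f p.
Proof.
move=> plf; have := laplacian_lin 1 p plf (graph_PL_cst k).
by under eq_fun do rewrite mul1r; rewrite laplacian_cst mul1r addr0.
Qed.

(** Where [f] touches [g] from below, none of its outgoing slopes exceeds that of [g]; the sign in
    [laplacian] reverses the inequality. This is what keeps minima of potentials effective. *)
Lemma laplacian_ge f g p : graph_PL f -> graph_PL g ->
  (forall q, f q <= g q) -> f p = g p -> laplacian g p <= laplacian f p.
Proof.
move=> /graph_PLP plf /graph_PLP plg fg; case: (gpointP p) => [v fgp|e t te fgp].
  rewrite /laplacian lerN2 /=; apply: lerD; apply: ler_sum => e /eqP ev.
    apply: slope_fwd_le (plf e) (plg e) _ _ _ _ => //=; first exact: len_gt0.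
    by rewrite edge_point0 ev.
  apply: slope_bwd_le (plf e) (plg e) _ _ _ _ => //=; first exact: len_gt0.
  by rewrite edge_point_len ev.
rewrite !laplacian_interior// /kink lerN2; case/andP: te => t0 tl.
apply: lerD.
  by apply: slope_fwd_le (plf e) (plg e) _ _ _ _ => //=; apply: ltW.
by apply: slope_bwd_le (plf e) (plg e) _ _ _ _ => //=; apply: ltW.
Qed.

(** * Divisors and their degrees *)

Lemma R_divisorP D : R_divisor D <->
  exists2 r : seq (gpoint G), uniq r & forall p, p \notin r -> D p = 0.
Proof.
split=> [/finite_seqP[r rE]|[r ur rD]].
  exists (undup r); first exact: undup_uniq.
  move=> p; rewrite mem_undup => /negP pr; apply/eqP/negPn/negP => Dp; apply: pr.
  by have : [set p | D p != 0] p by []; rewrite rE.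
apply: (sub_finite_set _ (finite_seq r)) => p /= Dp.
by apply/negPn/negP => /rD; apply/eqP.
Qed.

Lemma degreeE (r : seq (gpoint G)) D : uniq r ->
  (forall p, p \notin r -> D p = 0) -> degree D = \sum_(p <- r) D p.
Proof.
move=> ur rD; rewrite /degree [RHS]fsbig_seq//; apply/esym.
by apply: fsbig_widen => // p [_ /= /negP/rD].
Qed.

Lemma R_divisor_lin k D E : R_divisor D -> R_divisor E ->
  R_divisor (fun p => k * D p + E p) /\
  degree (fun p => k * D p + E p) = k * degree D + degree E.
Proof.
move=> /R_divisorP[r1 u1 r1D] /R_divisorP[r2 u2 r2E].
pose r := undup (r1 ++ r2).
have ur : uniq r by exact: undup_uniq.
have rD p : p \notin r -> D p = 0.
  by rewrite mem_undup mem_cat negb_or => /andP[/r1D].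
have rE p : p \notin r -> E p = 0.
  by rewrite mem_undup mem_cat negb_or => /andP[_ /r2E].
have rDE p : p \notin r -> k * D p + E p = 0.
  by move=> pr; rewrite rD// rE// mulr0 addr0.
split; first by apply/R_divisorP; exists r.
by rewrite (degreeE ur rDE) (degreeE ur rD) (degreeE ur rE) big_split mulr_sumr.
Qed.

(** By [pl_kinks] the interior of an edge contributes the sum of the outgoing slopes at its two
    ends, and the vertices contribute the same slopes with the opposite sign. *)
Lemma degree_laplacian f : graph_PL f ->
  R_divisor (laplacian f) /\ degree (laplacian f) = 0.
Proof.
move=> /graph_PLP plf.
have /choice[k kP] := fun e => pl_kinks (plf e).
pose r1 : seq (gpoint G) := [seq inl v | v <- enum (vert G)].
pose r2 := [seq edge_point e t | e <- enum (edge G), t <- k e].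
have ur : uniq (r1 ++ r2).
  rewrite cat_uniq; apply/and3P; split.
  - by rewrite map_inj_uniq ?enum_uniq// => u v [].
  - apply/hasPn => p /allpairsPdep[e [t [_ tk ->]]].
    have [_ /(_ _ tk) tin _ _] := kP e.
    by rewrite edge_point_interior; apply/negP => /mapP[].
  - apply: allpairs_uniq_dep => [|e _|]; first exact: enum_uniq.
      by have [] := kP e.
    move=> x y /allpairsPdep[e [t [_ tk ->]]] /allpairsPdep[e' [t' [_ tk' ->]]] /=.
    have [_ /(_ _ tk) tin _ _] := kP e; have [_ /(_ _ tk') tin' _ _] := kP e'.
    by move=> /(edge_point_inj tin tin')[ee' tt']; rewrite tt' -ee'.
have r0 p : p \notin r1 ++ r2 -> laplacian f p = 0.
  rewrite mem_cat negb_or; case: (gpointP p) => [v|e t te].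
    by case/andP => /negP[]; apply/mapP; exists v => //; rewrite mem_enum.
  case/andP => _ tr2; rewrite laplacian_interior//.
  have [_ _ k0 _] := kP e; rewrite k0// ?oppr0//.
  apply: contra tr2 => tk; apply/allpairsPdep; exists e, t.
  by rewrite mem_enum.
split; first by apply/R_divisorP; exists (r1 ++ r2).
rewrite (degreeE ur r0) big_cat /= big_map big_allpairs_dep /= !big_enum /=.
rewrite [X in _ + X](eq_bigr (fun e => slope_fwd (f \o edge_point e) 0
   + slope_bwd (f \o edge_point e) (len e))); last first.
  move=> e _; have [_ kin _ kS] := kP e.
  rewrite -[RHS]opprK -kS -sumrN; apply: eq_big_seq => t /kin tin.
  by rewrite laplacian_interior.
rewrite /laplacian sumrN !big_split /=.
(* Each edge has one source and one target, so the double sums over vertices and incident edges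
   become sums over the edges. *)
rewrite -(partition_big (@src _ G) predT (P := predT)
  (F := fun e => slope_fwd (f \o edge_point e) 0))//=.
rewrite -(partition_big (@tgt _ G) predT (P := predT)
  (F := fun e => slope_bwd (f \o edge_point e) (len e)))//=.
by rewrite addNr.
Qed.

Lemma edge_affine f e : affine_on (f \o edge_point e) 0 (len e) ->
  forall t, 0 <= t <= len e -> (f \o edge_point e) t =
    f (inl (src e)) + (f (inl (tgt e)) - f (inl (src e))) / len e * t.
Proof.
move=> [c [s fE]] t tin; have l0 := len_gt0 e.
rewrite -edge_point0 -edge_point_len.
have := fE 0; have := fE (len e); have := fE t => /=.
rewrite !lexx (ltW l0) tin => /(_ isT) -> /(_ isT) -> /(_ isT) ->.
by field; apply: lt0r_neq0.
Qed.

(* Maximum principle: [f] is affine on the edges, and at a vertex where it is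
   maximal all the outgoing slopes are nonpositive with sum 0. *)
Lemma laplacian_eq0 f : graph_PL f -> (forall p, laplacian f p = 0) ->
  exists c, forall p, f p = c.
Proof.
move=> /graph_PLP plf f0.
have faff e t : 0 <= t <= len e -> (f \o edge_point e) t =
    f (inl (src e)) + (f (inl (tgt e)) - f (inl (src e))) / len e * t.
  move: t; apply: edge_affine; apply: pl_affine_on (plf e) _ => t te.
  have := f0 (edge_point e t).
  by rewrite laplacian_interior// => /eqP; rewrite oppr_eq0 => /eqP.
have sfwd e : slope_fwd (f \o edge_point e) 0 =
    (f (inl (tgt e)) - f (inl (src e))) / len e.
  exact: fwd_germE (affine_fwd_germ (faff e) (lexx 0) (len_gt0 e)).
have sbwd e : slope_bwd (f \o edge_point e) (len e) =
    - ((f (inl (tgt e)) - f (inl (src e))) / len e).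
  exact: bwd_germE (affine_bwd_germ (faff e) (len_gt0 e) (lexx _)).
have [v0 _] := card_gt0P (vert_gt0 G).
pose v1 := [arg max_(v > v0) f (inl v)]%O.
have v1max v : f (inl v) <= f (inl v1).
  by rewrite /v1; case: Order.TotalTheory.arg_maxP => // w _; apply.
(* Maximality passes across every edge in both directions, because a sum of nonnegative terms
   vanishes only termwise. *)
have nbr e : (f (inl (src e)) == f (inl v1)) = (f (inl (tgt e)) == f (inl v1)).
  have sum0 v : f (inl v) = f (inl v1) ->
    (forall e, src e = v -> f (inl (tgt e)) = f (inl v1)) /\
    (forall e, tgt e = v -> f (inl (src e)) = f (inl v1)).
    move=> fv; have := f0 (inl v); rewrite /laplacian /=.
    rewrite opprD -!sumrN.
    have ge1 e' : src e' == v -> 0 <= - slope_fwd (f \o edge_point e') 0.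
      move=> /eqP ev; rewrite sfwd ev -mulNr opprB divr_ge0 ?(ltW (len_gt0 e'))//.
      by rewrite subr_ge0 fv.
    have ge2 e' : tgt e' == v -> 0 <= - slope_bwd (f \o edge_point e') (len e').
      move=> /eqP ev; rewrite sbwd opprK ev divr_ge0 ?(ltW (len_gt0 e'))//.
      by rewrite subr_ge0 fv.
    move=> /eqP; rewrite paddr_eq0 ?sumr_ge0// => /andP[].
    rewrite !psumr_eq0// => /allP h1 /allP h2; split=> e' ev.
      have := h1 e' (mem_index_enum _); rewrite ev eqxx sfwd ev fv oppr_eq0 /=.
      by rewrite mulf_eq0 invr_eq0 [len _ == 0]gt_eqF ?len_gt0// orbF subr_eq0 => /eqP.
    have := h2 e' (mem_index_enum _); rewrite ev eqxx sbwd ev fv opprK /=.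
    by rewrite mulf_eq0 invr_eq0 [len _ == 0]gt_eqF ?len_gt0// orbF subr_eq0 => /eqP.
  by apply/eqP/eqP => /sum0[h1 h2]; [apply: h1|apply: h2].
have allv v : f (inl v) = f (inl v1).
  have /connectP[s ps ->] := graph_connected v1 v.
  move: ps; set r := (X in path X _ _) => ps.
  suff H u : path r u s -> f (inl u) = f (inl v1) ->
      f (inl (last u s)) = f (inl v1) by exact: H ps _.
  elim: s u {ps} => //= w s IH u /andP[/existsP[e ew] ps] fu.
  apply: IH ps _; apply/eqP; move: ew (nbr e).
  by case/orP => /andP[/eqP-> /eqP->]; rewrite fu eqxx; [move=> <-|move=> ->].
exists (f (inl v1)) => p; case: (gpointP p) => [v|e t te]; first exact: allv.
have /= -> := faff e t; last by case/andP: te => *; rewrite !ltW.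
by rewrite !allv subrr mul0r mul0r addr0.
Qed.

(** Finitely many candidates suffice: the vertices, and one minimizer for each closed edge. *)
Lemma graph_PL_argmin f : graph_PL f -> exists p, forall q, f p <= f q.
Proof.
move=> /graph_PLP plf.
have H e : exists x, forall t, 0 <= t <= len e ->
    f (edge_point e x) <= f (edge_point e t).
  by have [x _ xm] := pl_argmin (plf e); exists x.
have {H} /choice[x xP] := H.
have [v0 _] := card_gt0P (vert_gt0 G).
pose c (i : vert G + edge G) : gpoint G :=
  match i with inl v => inl v | inr e => edge_point e (x e) end.
pose i1 := [arg min_(i < inl v0) f (c i)]%O.
have i1min i : f (c i1) <= f (c i).
  by rewrite /i1; case: Order.TotalTheory.arg_minP => // w _; apply.
exists (c i1) => q; case: (gpointP q) => [v|e t /andP[t0 tl]].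
  exact: (i1min (inl v)).
by apply: le_trans (i1min (inr e)) _; apply: xP; rewrite !ltW.
Qed.

Lemma fminE f p : (forall q, f p <= f q) -> fmin f = f p.
Proof.
move=> pm; apply/eqP; rewrite eq_le; apply/andP; split.
  apply: ge_inf; last by exists p.
  by exists (f p) => _ [q _ <-].
by apply: lb_le_inf; [exists (f p), p|move=> _ [q _ <-]].
Qed.

Lemma fmaxE f p : (forall q, f q <= f p) -> fmax f = f p.
Proof.
move=> pm; apply/eqP; rewrite eq_le; apply/andP; split.
  by apply: sup_le_ub; [exists (f p), p|move=> _ [q _ <-]].
by apply: sup_upper_bound; [split; [exists (f p), p|exists (f p) => _ [q _ <-]]|exists p].
Qed.

Lemma fmin_attained f : graph_PL f ->
  exists2 p, f p = fmin f & forall q, fmin f <= f q.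
Proof. by move=> /graph_PL_argmin[p pm]; exists p; rewrite (fminE pm). Qed.

Lemma fmax_attained f : graph_PL f ->
  exists2 p, f p = fmax f & forall q, f q <= fmax f.
Proof.
move=> plf; have [|p pm] := @graph_PL_argmin (fun p => (-1) * f p + 0).
  exact: graph_PL_lin (graph_PL_cst 0).
have {}pm q : f q <= f p by have := pm q; rewrite !mulN1r !addr0 lerN2.
by exists p; rewrite (fmaxE pm).
Qed.

End Graph.

(** * Existence and uniqueness of potentials *)

Section Potential.
Context {R : realType} {G : metric_graph R}.
Implicit Types (f g : gpoint G -> R) (D E : gpoint G -> R) (e : edge G)
  (p q : gpoint G).

Lemma kink_affine (g : R -> R) (a b c s t : R) :
  (forall t, a <= t <= b -> g t = c + s * t) -> a < t < b -> kink g t = 0.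
Proof.
move=> gE /andP[at_ tb]; rewrite /kink.
by rewrite (fwd_germE (affine_fwd_germ gE (ltW at_) tb))
  (bwd_germE (affine_bwd_germ gE at_ (ltW tb))) subrr.
Qed.

(* The Green function of the edge [e] with pole at [s], extended by 0. *)
Definition tent e (s : R) : gpoint G -> R := fun q =>
  match q with
  | inl _ => 0
  | inr x => let: (e', t) := val x in
      if e' == e then
        (if t <= s then t * (len e - s) else s * (len e - t)) / len e
      else 0
  end.

Lemma tent_edge e s t : 0 < s < len e -> 0 <= t <= len e ->
  tent e s (edge_point e t) =
  (if t <= s then t * (len e - s) else s * (len e - t)) / len e.
Proof.
move=> /andP[s0 sl] /andP[].
rewrite le_eqVlt => /predU1P[<- _|t0].
  by rewrite edge_point0 /= (ltW s0) !mul0r.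
rewrite le_eqVlt => /predU1P[->|tl].
  by rewrite edge_point_len /= leNgt sl /= subrr mulr0 mul0r.
by rewrite edge_point_interior ?t0// => te /=; rewrite eqxx.
Qed.

Lemma tent_other e e' s t : e' != e -> tent e s (edge_point e' t) = 0.
Proof.
move=> ee'; rewrite /edge_point; case: insubP => [u _ uE|_]; last by case: ifP.
by rewrite /= uE (negbTE ee').
Qed.

Lemma tent_left e s t : 0 < s < len e -> 0 <= t <= s ->
  (tent e s \o edge_point e) t = 0 + (len e - s) / len e * t.
Proof.
move=> se tin; have l0 := len_gt0 e; rewrite /= tent_edge//; last lra.
by have -> : t <= s by [lra]; field; apply: lt0r_neq0.
Qed.

Lemma tent_right e s t : 0 < s < len e -> s <= t <= len e ->
  (tent e s \o edge_point e) t = s + (- s / len e) * t.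
Proof.
move=> se tin; have l0 := len_gt0 e; rewrite /= tent_edge//; last lra.
case: ifP => ts; last by field; apply: lt0r_neq0.
have -> : t = s by lra.
by field; apply: lt0r_neq0.
Qed.

Lemma graph_PL_tent e s : 0 < s < len e -> graph_PL (tent e s).
Proof.
move=> /[dup] se /andP[s0 sl]; apply/graph_PLP => e'.
have [->|ee'] := eqVneq e' e.
  apply: (@pl_cat _ _ _ s).
    by apply: pl_affine => //; exists 0, ((len e - s) / len e) => t; apply: tent_left.
  by apply: pl_affine => //; exists s, (- s / len e) => t; apply: tent_right.
apply: pl_affine (len_gt0 e') _; exists 0, 0 => t _ /=.
by rewrite tent_other// mul0r addr0.
Qed.

Lemma laplacian_tent e e' s t : 0 < s < len e -> 0 < t < len e' ->
  laplacian (tent e s) (edge_point e' t) = ((e' == e) && (t == s))%:R.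
Proof.
move=> /[dup] se /andP[s0 sl] te; rewrite laplacian_interior//.
have [ee'|ee'] := eqVneq e' e; last first.
  rewrite (@kink_affine _ 0 (len e') 0 0) ?oppr0// => u _ /=.
  by rewrite tent_other// mul0r addr0.
subst e'; case/andP: te => t0 tl; case: (ltrgtP t s) => ts.
- by rewrite (kink_affine (fun u => tent_left se (t := u))) ?oppr0// t0.
- by rewrite (kink_affine (fun u => tent_right se (t := u))) ?oppr0// ts.
(* At the pole the derivative falls from [(len e - s) / len e] to [- s / len e], a drop of exactly
   1. *)
- rewrite ts /kink.
  rewrite (fwd_germE (affine_fwd_germ (fun u => tent_right se (t := u)) (lexx s) sl)).
  rewrite (bwd_germE (affine_bwd_germ (fun u => tent_left se (t := u)) s0 (lexx s))).
  by rewrite /=; field; apply: lt0r_neq0; apply: len_gt0.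
Qed.

(** Green functions clear the points of [r] one at a time. Vertices in [r] are skipped: the
    Laplacian at the vertices is left uncontrolled here and corrected by [vertex_potential]. *)
Lemma interior_potential (r : seq (gpoint G)) D :
  (forall e t, 0 < t < len e -> edge_point e t \notin r -> D (edge_point e t) = 0) ->
  exists2 f, graph_PL f & forall e t, 0 < t < len e ->
    laplacian f (edge_point e t) = D (edge_point e t).
Proof.
elim: r D => [|p r IH] D Dr.
  exists (fun _ => 0); first exact: graph_PL_cst.
  by move=> e t te; rewrite laplacian_cst Dr.
case: (gpointP p) Dr => [v|e s se] Dr.
  by apply: IH => e t te tr; apply: Dr; rewrite // inE negb_or tr edge_point_interior.
have [|f plf fE] := IH (fun q => D q - D (edge_point e s) * laplacian (tent e s) q).
  move=> e' t te tr; rewrite laplacian_tent//.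
  have [/andP[/eqP-> /eqP->]|H] := boolP (_ && _); first by rewrite mulr1 subrr.
  rewrite mulr0 subr0 Dr// inE negb_or tr andbT.
  by apply: contra H => /eqP /(edge_point_inj te se)[-> ->]; rewrite !eqxx.
exists (fun q => D (edge_point e s) * tent e s q + f q).
  by apply: graph_PL_lin => //; apply: graph_PL_tent.
move=> e' t te; rewrite laplacian_lin//; last exact: graph_PL_tent.
by rewrite fE//; ring.
Qed.

Definition interp (x : vert G -> R) : gpoint G -> R := fun q =>
  match q with
  | inl v => x v
  | inr y => let: (e, t) := val y in
      x (src e) + (x (tgt e) - x (src e)) / len e * t
  end.

Lemma interp_edge x e t : 0 <= t <= len e ->
  (interp x \o edge_point e) t = x (src e) + (x (tgt e) - x (src e)) / len e * t.
Proof.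
move=> /andP[] /=; rewrite le_eqVlt => /predU1P[<- _|t0].
  by rewrite edge_point0 mulr0 addr0.
rewrite le_eqVlt => /predU1P[->|tl].
  by rewrite edge_point_len /=; field; apply: lt0r_neq0; apply: len_gt0.
by rewrite edge_point_interior ?t0.
Qed.

Lemma graph_PL_interp x : graph_PL (interp x).
Proof.
apply/graph_PLP => e; apply: pl_affine (len_gt0 e) _.
by exists (x (src e)), ((x (tgt e) - x (src e)) / len e) => t; apply: interp_edge.
Qed.

Lemma laplacian_interp_interior x e t : 0 < t < len e ->
  laplacian (interp x) (edge_point e t) = 0.
Proof.
move=> te; rewrite laplacian_interior//.
by rewrite (kink_affine (@interp_edge x e) te) oppr0.
Qed.

Lemma interp_lin k x y p :
  interp (fun v => k * x v + y v) p = k * interp x p + interp y p.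
Proof. by case: p => [//|[[e t] te]] /=; ring. Qed.

Lemma degree_vertices D : (forall e t, 0 < t < len e -> D (edge_point e t) = 0) ->
  degree D = \sum_v D (inl v).
Proof.
move=> D0; rewrite (@degreeE _ _ [seq inl v | v <- enum (vert G)]).
- by rewrite big_map big_enum.
- by rewrite map_inj_uniq ?enum_uniq// => u v [].
- move=> p; case: (gpointP p) => [v|e t te _]; last exact: D0.
  by move/negP; case; apply/mapP; exists v => //; rewrite mem_enum.
Qed.

Lemma sum_laplacian_interp x : \sum_v laplacian (interp x) (inl v) = 0.
Proof.
rewrite -degree_vertices; last exact: laplacian_interp_interior.
by have [] := degree_laplacian (graph_PL_interp x).
Qed.

(* The rank one term makes the vertex Laplacian invertible. *)
Definition vertex_map (x : 'rV[R]_#|vert G|) : 'rV[R]_#|vert G| :=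
  \row_j (laplacian (interp (fun v => x 0 (enum_rank v))) (inl (enum_val j))
    + \sum_k x 0 k).

Fact vertex_map_linear : linear vertex_map.
Proof.
move=> k x y; apply/rowP => j; rewrite !mxE.
set u := fun v => x 0 (enum_rank v); set w := fun v => y 0 (enum_rank v).
have -> : interp (fun v => (k *: x + y) 0 (enum_rank v)) =
    fun p => k * interp u p + interp w p.
  apply/funext => p; rewrite -interp_lin; congr (interp _ _).
  by apply/funext => v; rewrite !mxE.
rewrite laplacian_lin; [|exact: graph_PL_interp..].
rewrite (eq_bigr (fun i => k * x 0 i + y 0 i)); last by move=> i _; rewrite !mxE.
by rewrite big_split /= -mulr_sumr; ring.
Qed.

HB.instance Definition _ :=
  GRing.isLinear.Build R 'rV[R]_#|vert G| 'rV[R]_#|vert G| _ vertex_map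
    vertex_map_linear.

(** The Laplacian part has total 0, so the sum of the coordinates isolates the rank one term. *)
Lemma sum_vertex_map x :
  \sum_j vertex_map x 0 j = (\sum_k x 0 k) *+ #|vert G|.
Proof.
rewrite /vertex_map (eq_bigr _ (fun j _ => mxE _ _ _ _)) big_split /=.
rewrite sumr_const card_ord.
have -> : \sum_(j < #|vert G|) laplacian (interp (fun v => x 0 (enum_rank v)))
    (inl (enum_val j)) = 0; last by rewrite add0r.
rewrite -[RHS](sum_laplacian_interp (fun v => x 0 (enum_rank v))).
rewrite [RHS](reindex (@enum_val _ (vert G))) //=.
exact: onW_bij (enum_val_bij _).
Qed.

Lemma sum_eq0_of_vertex_map x : \sum_j vertex_map x 0 j = 0 -> \sum_k x 0 k = 0.
Proof.
by rewrite sum_vertex_map => /eqP; rewrite mulrn_eq0 eqn0Ngt vert_gt0 => /eqP.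
Qed.

(** Summing the coordinates kills the rank one term. The interpolation then has Laplacian 0, hence
    is constant, and a constant vector with sum 0 vanishes. *)
Lemma vertex_map_inj x : vertex_map x = 0 -> x = 0.
Proof.
move=> x0; have s0 : \sum_k x 0 k = 0.
  by apply: sum_eq0_of_vertex_map; rewrite x0 big1// => j _; rewrite mxE.
have [|c cE] := laplacian_eq0 (graph_PL_interp (fun v => x 0 (enum_rank v))).
  move=> p; case: (gpointP p) => [v|e t te]; last exact: laplacian_interp_interior.
  have /rowP/(_ (enum_rank v)) := x0.
  by rewrite !mxE s0 addr0 enum_rankK.
have xc k : x 0 k = c by rewrite -(cE (inl (enum_val k))) /= enum_valK.
move: s0; under eq_bigr do rewrite xc; rewrite sumr_const card_ord => /eqP.
rewrite mulrn_eq0 eqn0Ngt vert_gt0 => /eqP c0.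
by apply/rowP => k; rewrite xc c0 mxE.
Qed.

(** The solution of the perturbed system also solves the original one: its coordinates sum to 0
    because those of [b] do, so the added term vanishes. *)
Lemma vertex_potential (b : vert G -> R) : \sum_v b v = 0 ->
  exists x, forall v, laplacian (interp x) (inl v) = b v.
Proof.
move=> b0; pose A := lin1_mx vertex_map.
have Au : A \in unitmx.
  rewrite -row_free_unit; apply: inj_row_free => x.
  by rewrite mul_rV_lin1; apply: vertex_map_inj.
pose y : 'rV[R]_#|vert G| := \row_j b (enum_val j).
pose x := y *m invmx A.
have xy : vertex_map x = y by rewrite -(mul_rV_lin1 vertex_map) mulmxKV.
have s0 : \sum_k x 0 k = 0.
  apply: sum_eq0_of_vertex_map; rewrite xy -[RHS]b0.
  rewrite [RHS](reindex (@enum_val _ (vert G))) /=.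
    by apply: eq_bigr => j _; rewrite mxE.
  exact: onW_bij (enum_val_bij _).
exists (fun v => x 0 (enum_rank v)) => v.
have /rowP/(_ (enum_rank v)) := xy.
by rewrite !mxE s0 addr0 enum_rankK.
Qed.

(** Once the Laplacian is right inside the edges, the defect is supported on the vertices and has
    degree 0; an edgewise affine function corrects it without affecting the Laplacian inside the
    edges. *)
Lemma potential_exists D : R_divisor D -> degree D = 0 ->
  exists2 f, graph_PL f & laplacian f = D.
Proof.
move=> divD degD; have /R_divisorP[r _ rD] := divD.
have [|f plf fE] := @interior_potential r D; first by move=> e t _; apply: rD.
have [divf degf] := degree_laplacian plf.
have [x xE] : exists x, forall v,
    laplacian (interp x) (inl v) = D (inl v) - laplacian f (inl v).
  apply: vertex_potential.
  transitivity (degree (fun p => -1 * laplacian f p + D p)); last first.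
    by have [_ ->] := R_divisor_lin (-1) divf divD; rewrite degf degD; ring.
  rewrite degree_vertices; last by move=> e t te; rewrite fE//; ring.
  by apply: eq_bigr => v _; ring.
exists (fun p => 1 * interp x p + f p).
  by apply: graph_PL_lin plf; apply: graph_PL_interp.
apply/funext => p; rewrite laplacian_lin//; last exact: graph_PL_interp.
case: (gpointP p) => [v|e t te]; first by rewrite xE; ring.
by rewrite laplacian_interp_interior// fE//; ring.
Qed.

(** Existence rules out the default value of [xget] in [potential]. *)
Lemma potential_spec D : R_divisor D -> degree D = 0 ->
  graph_PL (potential D) /\ laplacian (potential D) = D.
Proof.
move=> divD degD; have [f plf fE] := potential_exists divD degD.
by rewrite /potential; case: xgetP => [g _ []//|/(_ f)]; case; split.
Qed.

Lemma potential_unique f : graph_PL f ->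
  exists c, forall p, potential (laplacian f) p = f p + c.
Proof.
move=> plf; have [divf degf] := degree_laplacian plf.
have [plg gE] := potential_spec divf degf.
have [|c cE] := laplacian_eq0 (graph_PL_lin (-1) plf plg).
  by move=> p; rewrite laplacian_lin// gE; ring.
by exists c => p; rewrite -(cE p); ring.
Qed.

Lemma Div_eff_sub d D E : Div_eff d D -> Div_eff d E ->
  graph_PL (potential (D - E)) /\ laplacian (potential (D - E)) = D - E.
Proof.
move=> [divD _ degD] [divE _ degE].
have [] := R_divisor_lin (-1) divE divD; rewrite degD degE.
have -> : (fun p => -1 * E p + D p) = D - E by apply/funext => p; rewrite mulN1r addrC.
by rewrite mulN1r addNr; apply: potential_spec.
Qed.

End Potential.

(** * Integrals of piecewise linear functions *)

Section PiecewiseLinearIntegral.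
Context {R : realType}.
Implicit Types (f g : R -> R) (a b : R).
Local Notation mu := (@lebesgue_measure R).

Lemma pl_integrable f a b : pl f a b -> mu.-integrable `[a, b] (EFin \o f).
Proof.
move=> /pl_lipschitz[K K0 fK]; apply: continuous_compact_integrable.
  exact: segment_compact.
apply/subspace_continuousP => x; rewrite /= in_itv /= => xab.
(* [K] may be 0, so the modulus of continuity divides by [K + 1]. *)
have K1 : 0 < K + 1 by lra.
apply/cvgrPdist_lt => e e0; rewrite near_withinE.
near=> y; rewrite /= in_itv /= => yab.
apply: le_lt_trans (fK x y xab yab) _.
have : `|x - y| < e / (K + 1).
  by near: y; apply/nbhs_normP; exists (e / (K + 1)) => /=; rewrite ?divr_gt0.
rewrite ltr_pdivlMr// => H; have := normr_ge0 (x - y); nra.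
Unshelve. all: by end_near. Qed.

(** A positive value persists, up to a factor 1/2, on an interval of positive length, which would
    make the integral positive. *)
Lemma pl_Rintegral_eq0 f a b t : pl f a b ->
  (forall t, a <= t <= b -> 0 <= f t) -> \int[mu]_(x in `[a, b]) f x <= 0 ->
  a <= t <= b -> f t = 0.
Proof.
move=> plf f0 If tab; apply/eqP; rewrite -[_ == _]negbK; apply/negP => ft0.
have {ft0} ft : 0 < f t by rewrite lt_neqAle eq_sym ft0 f0.
have [K K0 fK] := pl_lipschitz plf; have ab := pl_lt plf.
(* The first bound lets [f] lose at most half of [f t] within distance [r]; the second leaves room
   in [[a, b]] for an interval of length [r] on one side of [t]. *)
pose r := Num.min (f t / (2 * (K + 1))) ((b - a) / 2).
have K1 : 0 < 2 * (K + 1) by lra.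
have r0 : 0 < r by rewrite lt_min !divr_gt0//; lra.
have rK : r * (2 * (K + 1)) <= f t by rewrite -ler_pdivlMr// /r ge_min lexx.
have rab : r <= (b - a) / 2 by rewrite /r ge_min lexx orbT.
have [x [y [ax xy yb xyf]]] : exists x y, [/\ a <= x, x < y, y <= b &
    forall z, x <= z <= y -> `|t - z| <= r].
  have [tr|tr] := lerP (t + r) b.
    exists t, (t + r); split; try lra; move=> z zin; rewrite ler_norml; lra.
  exists (t - r), t; split; try lra; move=> z zin; rewrite ler_norml; lra.
have fxy z : x <= z <= y -> f t / 2 <= f z.
  move=> zin; have := fK t z tab; have zab : a <= z <= b by lra.
  move=> /(_ zab); rewrite ler_norml => /andP[_].
  by have := xyf z zin; have := normr_ge0 (t - z); nra.
have xyab : `[x, y]%classic `<=` `[a, b]%classic.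
  by move=> z; rewrite /= !in_itv /=; lra.
have If' := pl_integrable plf.
have Ixy : mu.-integrable `[x, y] (EFin \o f).
  by apply: integrableS If'.
have sub : \int[mu]_(z in `[x, y]) f z <= \int[mu]_(z in `[a, b]) f z.
  rewrite /Rintegral fine_le//.
  - exact: integrable_fin_num.
  - exact: integrable_fin_num.
  - by apply: ge0_subset_integral => //; apply: (measurable_int mu).
have : \int[mu]_(z in `[x, y]) (f t / 2) <= \int[mu]_(z in `[x, y]) f z.
  apply: le_Rintegral => //.
  have := pl_integrable (pl_linear (f t / 2) 0 xy).
  by apply: eq_integrable => // z _ /=; rewrite mul0r addr0.
rewrite Rintegral_cst//= lebesgue_measure_itv /= lte_fin xy -EFinB /= => H.
have := le_trans H (le_trans sub If).
by rewrite leNgt mulr_gt0 ?divr_gt0 ?subr_gt0.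
Qed.

Lemma pl_Rintegral_le f g a b : pl f a b -> pl g a b ->
  (forall t, a <= t <= b -> f t <= g t) ->
  \int[mu]_(x in `[a, b]) f x <= \int[mu]_(x in `[a, b]) g x.
Proof.
by move=> plf plg fg; apply: le_Rintegral => //; apply: pl_integrable.
Qed.

Lemma pl_Rintegral_inj f g a b : pl f a b -> pl g a b ->
  (forall t, a <= t <= b -> f t <= g t) ->
  \int[mu]_(x in `[a, b]) g x <= \int[mu]_(x in `[a, b]) f x ->
  forall t, a <= t <= b -> f t = g t.
Proof.
move=> plf plg fg Igf t tab.
have plh : pl (fun x => g x - f x) a b.
  by apply: eq_pl (pl_add plg (pl_scale (-1) plf)) => x _; rewrite mulN1r.
have := @pl_Rintegral_eq0 _ a b t plh _ _ tab.
rewrite RintegralB//; try exact: pl_integrable.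
move=> H; suff : g t - f t = 0 by lra.
by apply: H => [x /fg|]; rewrite ?subr_ge0 ?subr_le0.
Qed.

End PiecewiseLinearIntegral.

(** * Normalized potentials and tropical convexity *)

Section TropicalConvexity.
Context {R : realType} {G : metric_graph R}.
Implicit Types (f g : gpoint G -> R) (D E : gpoint G -> R) (e : edge G)
  (p q : gpoint G) (d : R).

(** The integrals compare edge by edge, so the reverse inequality between the totals forces equality
    on each edge. The integral does not see vertices that lie on no edge, hence the form of the
    conclusion. *)
Lemma graph_integral_inj f g : graph_PL f -> graph_PL g ->
  (forall p, f p <= g p) -> graph_integral g <= graph_integral f ->
  forall e t, 0 <= t <= len e -> f (edge_point e t) = g (edge_point e t).
Proof.
move=> /graph_PLP plf /graph_PLP plg fg; rewrite /graph_integral => Igf e.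
apply: (pl_Rintegral_inj (plf e) (plg e)) => [t _|]; first exact: fg.
have Ile e' := pl_Rintegral_le (plf e') (plg e') (fun t _ => fg _).
move: Igf; rewrite (bigD1 e)//= [leRHS](bigD1 e)//= => Igf.
have /= H := ler_sum _ (fun e' (_ : e' != e) => Ile e').
have := lerD Igf (H (index_enum _)).
by rewrite -!addrA [X in _ <= _ + X]addrC lerD2r.
Qed.

Definition normalized f : Prop :=
  [/\ graph_PL f, forall p, 0 <= f p & exists p, f p = 0].

(* An isolated vertex is the whole graph. *)
Lemma normalized_integral_inj f g : normalized f -> normalized g ->
  (forall p, f p <= g p) -> graph_integral g <= graph_integral f ->
  forall p, f p = g p.
Proof.
move=> [plf f0 [pf pf0]] [plg g0 [pg pg0]] fg Igf.
have fgE := graph_integral_inj plf plg fg Igf.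
have l0 e := ltW (len_gt0 e).
move=> p; case: (gpointP p) => [v|e t /andP[t0 tl]]; last by apply: fgE; rewrite !ltW.
have [/existsP[e /orP[]/eqP<-]|/existsPn noe] :=
  boolP [exists e, (src e == v) || (tgt e == v)].
- by rewrite -edge_point0 fgE ?lexx ?l0.
- by rewrite -edge_point_len fgE ?lexx ?l0.
suff all q : q = inl v by rewrite -(all pf) pf0 (all pf) -(all pg) pg0.
have allv w : w = v.
  have /connectP[s ps ->] := graph_connected v w.
  case: s ps => //= u s /andP[/existsP[e +] _].
  by have := noe e; rewrite negb_or => /andP[/negbTE-> /negbTE->]; rewrite andbF.
case: (gpointP q) => [w|e t _]; first by rewrite (allv w).
by have := noe e; rewrite (allv (src e)) eqxx.
Qed.

(** Subtracting the minimum removes the arbitrary constant in the choice of [potential]. *)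
Definition npotential D : gpoint G -> R :=
  fun p => potential D p - fmin (potential D).

Lemma normalized_npotential d D E : Div_eff d D -> Div_eff d E ->
  normalized (npotential (D - E)).
Proof.
move=> hD hE; have [plf _] := Div_eff_sub hD hE.
have [p pm fm] := fmin_attained plf; split.
- exact: graph_PL_addC.
- by move=> q; rewrite subr_ge0.
- by exists p; rewrite /npotential pm subrr.
Qed.

Lemma npotentialK d D E : Div_eff d D -> Div_eff d E ->
  E + laplacian (npotential (D - E)) = D.
Proof.
move=> hD hE; have [plf fE] := Div_eff_sub hD hE.
have -> : laplacian (npotential (D - E)) = D - E.
  by rewrite -fE; apply/funext => p; rewrite laplacian_addC ?fE.
by rewrite addrC subrK.
Qed.

Lemma npotential_laplacian f E p : graph_PL f ->
  npotential (E + laplacian f - E) p = f p - fmin f.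
Proof.
move=> plf; rewrite addrAC subrr add0r /npotential.
have [c cE] := potential_unique plf; have [q qm fm] := fmin_attained plf.
rewrite (@fminE _ _ _ q) => [|r]; first by rewrite !cE qm; ring.
by rewrite !cE lerD2r qm.
Qed.

(** At each point the minimum touches [f] or [g] from below, so its Laplacian there is at least that
    of the function touched. The degree persists because Laplacians have degree 0. *)
Lemma Div_eff_laplacian_min d E f g : Div_eff d E -> graph_PL f -> graph_PL g ->
  Div_eff d (E + laplacian f) -> Div_eff d (E + laplacian g) ->
  Div_eff d (E + laplacian (fun p => Num.min (f p) (g p))).
Proof.
move=> [divE _ degE] plf plg [_ f0 _] [_ g0 _].
have plm := graph_PL_min plf plg; have [divm degm] := degree_laplacian plm.
have [] := R_divisor_lin 1 divE divm; rewrite degE degm mul1r addr0.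
under eq_fun do rewrite mul1r.
move=> div deg; split=> // p.
have [fg|gf] := leP (f p) (g p).
  apply: le_trans (f0 p) _; rewrite lerD2l; apply: laplacian_ge => //.
    by move=> q; rewrite ge_min lexx.
  by rewrite min_l.
apply: le_trans (g0 p) _; rewrite lerD2l; apply: laplacian_ge => //.
  by move=> q; rewrite ge_min lexx orbT.
by rewrite min_r// ltW.
Qed.

Lemma laplacian_diff E f g : graph_PL f -> graph_PL g ->
  (E + laplacian g) - (E + laplacian f) = laplacian (fun p => -1 * f p + g p).
Proof.
move=> plf plg; apply/funext => p; rewrite laplacian_lin//.
by rewrite !fctE; ring.
Qed.

Lemma tsegment_potential E f g : graph_PL f -> graph_PL g ->
  exists k, forall p,
    potential ((E + laplacian g) - (E + laplacian f)) p = g p - f p + k.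
Proof.
move=> plf plg; have [k kE] := potential_unique (graph_PL_lin (-1) plf plg).
by exists k => p; rewrite laplacian_diff// kE; ring.
Qed.

(** The potential of the difference is [g - f] up to a constant; adding [f] inside the minimum that
    defines a point of the segment leaves a minimum of shifts of [f] and [g]. *)
Lemma tsegment_sub E f g D : graph_PL f -> graph_PL g ->
  tsegment (E + laplacian f) (E + laplacian g) D ->
  exists a b, D = E + laplacian (fun p => Num.min (f p + a) (g p + b)).
Proof.
move=> plf plg [t _ <-]; have [k kE] := tsegment_potential E plf plg.
set F := potential _ in kE *; set a := t * _.
exists a, (k - fmin F).
have -> : (fun p => Num.min (f p + a) (g p + (k - fmin F))) =
    (fun p => 1 * f p + Num.min a (F p - fmin F)).
  by apply/funext => p; rewrite mul1r addr_minr kE; congr Num.min; ring.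
apply/funext => p; rewrite !fctE laplacian_lin ?mul1r ?addrA//.
apply: graph_PL_min; first exact: graph_PL_cst.
have -> : (fun p => F p - fmin F) = (fun p => -1 * f p + (g p + (k - fmin F))).
  by apply/funext => q; rewrite kE; ring.
by apply: graph_PL_lin => //; apply: graph_PL_addC.
Qed.

Lemma tsegment_min E f g : normalized f -> normalized g ->
  tsegment (E + laplacian f) (E + laplacian g)
    (E + laplacian (fun p => Num.min (f p) (g p))).
Proof.
move=> [plf f0 [pf pf0]] [plg g0 [pg pg0]].
have [k kE] := tsegment_potential E plf plg.
rewrite /tsegment /rho; set F := potential _ in kE *.
have plF : graph_PL F.
  have -> : F = (fun p => -1 * f p + (g p + k)).
    by apply/funext => q; rewrite kE; ring.
  by apply: graph_PL_lin => //; apply: graph_PL_addC.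
have [_ _ mF] := fmin_attained plF; have [_ _ MF] := fmax_attained plF.
have mk : fmin F <= k.
  by have := mF pg; rewrite kE pg0; have := f0 pg; lra.
have kM : k <= fmax F.
  by have := MF pf; rewrite kE pf0; have := g0 pf; lra.
(* This parameter gives the cutoff [k - fmin F], for which the shifts of [f] and [g] coincide. It
   lies in the unit interval because [F] is at most [k] at a zero of [g] and at least [k] at a zero
   of [f]. *)
exists ((k - fmin F) / (fmax F - fmin F)).
  rewrite /= in_itv /= divr_ge0 ?subr_ge0 ?(le_trans mk)//=.
  (* If [F] is constant the denominator is 0, but so is the numerator. *)
  have [H|H] := ltP (fmin F) (fmax F); first by rewrite ler_pdivrMr ?subr_gt0//; lra.
  have -> : k - fmin F = 0 by lra.
  by rewrite mul0r.
have -> : (k - fmin F) / (fmax F - fmin F) * (fmax F - fmin F) = k - fmin F.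
  have [H|H] := ltP (fmin F) (fmax F); first by rewrite divfK// subr_eq0 gt_eqF.
  have -> : k - fmin F = 0 by lra.
  by rewrite mul0r mul0r.
set u := fun p => Num.min (k - fmin F) (F p - fmin F).
have plu : graph_PL u.
  by apply: graph_PL_min; [exact: graph_PL_cst|exact: graph_PL_addC].
have -> : (fun p => Num.min (f p) (g p)) = (fun p => (1 * f p + u p) + (fmin F - k)).
  apply/funext => p; rewrite mul1r addr_minr addr_minl kE.
  by congr Num.min; ring.
apply/funext => p; rewrite !fctE laplacian_addC; last exact: graph_PL_lin.
by rewrite laplacian_lin// mul1r addrA.
Qed.

(** Relative to the base point [D1], the segment consists of divisors of minima, to which
    [Div_eff_laplacian_min] applies. *)
Lemma tropically_convex_Div_eff d : tropically_convex d (@Div_eff R G d).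
Proof.
split=> // D1 D2 hD1 hD2 D.
rewrite -{1}(npotentialK hD1 hD1) -{1}(npotentialK hD2 hD1).
have [pl1 _ _] := normalized_npotential hD1 hD1.
have [pl2 _ _] := normalized_npotential hD2 hD1.
case/(tsegment_sub pl1 pl2) => a [b ->].
apply: Div_eff_laplacian_min => //; try exact: graph_PL_addC.
  have -> : laplacian (fun p => npotential (D1 - D1) p + a) =
      laplacian (npotential (D1 - D1)).
    by apply/funext => p; apply: laplacian_addC.
  by rewrite (npotentialK hD1 hD1).
have -> : laplacian (fun p => npotential (D2 - D1) p + b) =
    laplacian (npotential (D2 - D1)).
  by apply/funext => p; apply: laplacian_addC.
by rewrite (npotentialK hD2 hD1).
Qed.

Lemma tropically_convex_tconv d (S : set (gpoint G -> R)) :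
  S `<=` Div_eff d -> tropically_convex d (tconv d S).
Proof.
move=> SD; split=> [D /(_ (Div_eff d))|D1 D2 T1 T2 D D12 A [hA SA]].
  by apply; split=> //; apply: tropically_convex_Div_eff.
by apply: hA.2 D12; [apply: T1|apply: T2].
Qed.

Lemma sub_tconv d (S : set (gpoint G -> R)) : S `<=` tconv d S.
Proof. by move=> D SD A [_]; apply. Qed.

(** Evaluating the minimum of two shifted potentials at their zeros bounds its least value by both
    shifts; subtracting that value leaves, at each point, at least one of the two potentials. A
    general upward closed [P] can express domination of a pointwise minimum without forming it. *)
Lemma tropically_convex_npotential_ge d E (P : gpoint G -> R -> Prop) :
  Div_eff d E -> (forall p x y, P p x -> x <= y -> P p y) ->
  tropically_convex d
    [set D | Div_eff d D /\ forall p, P p (npotential (D - E) p)].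
Proof.
move=> hE Pmono; split=> [D []//|D1 D2 [hD1 P1] [hD2 P2] D D12]; split.
  exact: (tropically_convex_Div_eff d).2 D12.
move: D12; rewrite -{1}(npotentialK hD1 hE) -{1}(npotentialK hD2 hE).
have [pl1 _ [p1 p10]] := normalized_npotential hD1 hE.
have [pl2 _ [p2 p20]] := normalized_npotential hD2 hE.
case/(tsegment_sub pl1 pl2) => a [b ->] p.
set h := fun p => Num.min _ _.
have plh : graph_PL h by apply: graph_PL_min; apply: graph_PL_addC.
rewrite npotential_laplacian//; have [_ _ hm] := fmin_attained plh.
have ha : fmin h <= a.
  by apply: le_trans (hm p1) _; rewrite /h ge_min p10 add0r lexx.
have hb : fmin h <= b.
  by apply: le_trans (hm p2) _; rewrite /h ge_min p20 add0r lexx orbT.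
rewrite {1}/h; have [_|_] := leP (_ + a) (_ + b).
  by apply: Pmono (P1 p) _; lra.
by apply: Pmono (P2 p) _; lra.
Qed.

(** Iterates [tsegment_min] along the list, starting from [F i] since an empty family has no
    minimum. As every value of [g] is a value of some [F j], an exhaustive list makes [g] the
    pointwise minimum. *)
Lemma tropical_min d (A : set (gpoint G -> R)) E (I : eqType)
    (F : I -> gpoint G -> R) (i : I) (s : seq I) :
  tropically_convex d A -> (forall i, normalized (F i)) ->
  (forall i, A (E + laplacian (F i))) ->
  exists g, [/\ normalized g, A (E + laplacian g),
    forall p, exists j, g p = F j p &
    forall j p, j \in i :: s -> g p <= F j p].
Proof.
move=> [_ hA] nF AF; elim: s => [|k s [g [ng Ag gF gle]]].
  exists (F i); split=> // [p|j p]; first by exists i.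
  by rewrite inE => /eqP->.
exists (fun p => Num.min (F k p) (g p)); split.
- case: (nF k) (ng) => [plk k0 [q q0]] [plg g0 _]; split.
  + exact: graph_PL_min.
  + by move=> p; rewrite le_min k0 g0.
  + by exists q; rewrite q0 min_l.
- by apply: hA (AF k) Ag _ _; apply: tsegment_min.
- by move=> p; case: (leP (F k p) (g p)) => _; [exists k|].
- move=> j p; rewrite inE => /orP[/eqP ji|].
    by rewrite ge_min gle ?orbT// ji mem_head.
  rewrite inE => /orP[/eqP->|js]; first by rewrite ge_min lexx.
  by rewrite ge_min gle ?orbT// inE js orbT.
Qed.

Lemma Gamma_minE D p : Gamma_min (potential D) p <-> npotential D p = 0.
Proof.
rewrite /Gamma_min /npotential /=.
by split=> [->|/eqP]; [rewrite subrr|rewrite subr_eq0 => /eqP].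
Qed.

End TropicalConvexity.

Theorem theorem7p1 (R : realType) (G : metric_graph R) (d : R) (hd : 0 <= d)
    (n : nat) (Ds : 'I_n -> gpoint G -> R) (hDs : forall i, Div_eff d (Ds i))
    (E : gpoint G -> R) (hE : Div_eff d E) :
  (tconv d (range Ds) E <->
     \bigcup_(i in [set: 'I_n]) Gamma_min (potential (Ds i - E))
       = [set: gpoint G])
  /\ (forall D0 D : gpoint G -> R,
        is_reduced (tconv d (range Ds)) E D0 -> tconv d (range Ds) D ->
        Gamma_min (potential (D - E)) `<=` Gamma_min (potential (D0 - E)) /\
        Gamma_min (potential (D0 - E))
          = \bigcup_(i in [set: 'I_n]) Gamma_min (potential (Ds i - E))).
Proof.
set T := tconv d (range Ds); pose F i := npotential (Ds i - E).
have rDs : range Ds `<=` Div_eff d by move=> _ [i _ <-]; apply: hDs.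
have [TD _] := tropically_convex_tconv rDs.
have nF i : normalized (F i) := normalized_npotential (hDs i) hE.
have TF i : T (E + laplacian (F i)).
  by rewrite (npotentialK (hDs i) hE); apply: sub_tconv; exists i.
(* The hull lies in every tropically convex set containing the generators, in particular in the set
   of divisors whose potential dominates the minimum of the [F i]. This also shows that a nonempty
   hull has a generator. *)
have lowT D p : T D -> exists i, F i p <= npotential (D - E) p.
  move=> TDD.
  suff : [set D | Div_eff d D /\ forall p, exists i, F i p <= npotential (D - E) p] D.
    by case.
  apply: TDD; split; last first.
    by move=> _ [i _ <-]; split; [exact: hDs|move=> q; exists i].
  apply: (tropically_convex_npotential_ge
    (P := fun p x => exists i, F i p <= x)) hE _ => q x y [i Fx] xy.
  by exists i; apply: le_trans Fx xy.
have unionP p : (\bigcup_(i in [set: 'I_n]) Gamma_min (potential (Ds i - E))) p <->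
    exists i, F i p = 0.
  split=> [[i _ /Gamma_minE]|[i /Gamma_minE]]; first by exists i.
  by exists i.
have TminF (i0 : 'I_n) : exists g, [/\ normalized g, T (E + laplacian g),
    forall p, exists j, g p = F j p & forall j p, g p <= F j p].
  have [g [ng Tg gF gle]] := tropical_min i0 (enum 'I_n)
    (tropically_convex_tconv rDs) nF TF.
  by exists g; split=> // j p; apply: gle; rewrite inE mem_enum orbT.
have lap0 : E + laplacian (fun _ => 0) = E.
  by apply/funext => q; rewrite !fctE laplacian_cst addr0.
have potE p : npotential (E - E) p = 0.
  have := npotential_laplacian E p (graph_PL_cst 0); rewrite lap0 => ->.
  by rewrite (@fminE _ _ _ p) ?subrr.
split; first split.
(* The normalized potential of [E - E] is 0, so at each point it dominates, and thereby annihilates,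
   some nonnegative [F i]. *)
- move=> TE; apply/seteqP; split=> // p _; apply/unionP.
  have [i] := lowT E p TE; rewrite potE => Fi; exists i.
  by apply/eqP; rewrite eq_le Fi; have [_ ->] := nF i.
- move=> cover; have [v0 _] := card_gt0P (vert_gt0 G).
  have zero p : exists i, F i p = 0 by apply/unionP; rewrite cover.
  (* The covering of a vertex supplies the index required to form the minimum. *)
  have [i0 _] := zero (inl v0).
  have [g [[plg g0 _] Tg gF gle]] := TminF i0.
  suff gE : g = fun _ => 0 by move: Tg; rewrite gE lap0.
  apply/funext => p; have [i Fi] := zero p.
  by apply/eqP; rewrite eq_le g0 andbT -Fi gle.
- move=> D0 D [TD0 D0min] TDD; have [v0 _] := card_gt0P (vert_gt0 G).
  have [i0 _] := lowT D0 (inl v0) TD0.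
  have [g [ng Tg gF gle]] := TminF i0.
  have gT D' p : T D' -> g p <= npotential (D' - E) p.
    by move=> TD'; have [i] := lowT D' p TD'; apply: le_trans (gle i p).
  have [plg g0 [pg pg0]] := ng.
  have npg p : npotential (E + laplacian g - E) p = g p.
    by rewrite npotential_laplacian// (@fminE _ _ _ pg) pg0 ?subr0.
  (* Domination puts [g] below the potential of [D0 - E]. Since [E + laplacian g] is in the hull,
     reducedness reverses the inequality between the integrals, which forces equality. *)
  have D0g p : g p = npotential (D0 - E) p.
    apply: (normalized_integral_inj ng (normalized_npotential (TD _ TD0) hE)).
      by move=> q; apply: gT.
    have := D0min _ Tg; rewrite /frak_S; congr (_ <= graph_integral _).
    by apply/funext => q; rewrite -npg.
  split.
    (* A zero of any potential dominating the nonnegative [g] is a zero of [g]. *)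
    move=> p /Gamma_minE Dp; apply/Gamma_minE; rewrite -D0g.
    by apply/eqP; rewrite eq_le g0 andbT -Dp gT.
  apply/seteqP; split=> p.
    move/Gamma_minE; rewrite -D0g => gp; apply/unionP.
    by have [j gj] := gF p; exists j; rewrite -gj.
  move/unionP => [i Fi]; apply/Gamma_minE; rewrite -D0g.
  by apply/eqP; rewrite eq_le g0 andbT -Fi gle.
Qed.
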